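(* Let $f\in L^2(\mathbf R^d)$ have Hermite series expansion $f=\sum_{\alpha\in\mathbf N^d}c_\alpha(f)h_\alpha$. Then the following conditions are equivalent: (1) There exist $r>0$ and $C>0$ such that $$|c_\alpha(f)|\le C\, r^{|\alpha|}(\alpha!)^{-\frac12}\quad\text{for all }\alpha\in\mathbf N^d.$$ (2) There exist $r>0$ and $C>0$ such that $$\|H^Nf\|_{L^2}\le C\,2^N r^{\frac{N}{\log N}}\left(\frac{2N}{\log N}\right)^{N\left(1-\frac1{\log N}\right)}\quad\text{for all integers }N\ge 2.$$
   Context: $\mathbf N=\{0,1,2,\dots\}$. $(h_\alpha)_{\alpha\in\mathbf N^d}$ is the orthonormal basis of $L^2(\mathbf R^d)$ of (normalized) Hermite functions, and $c_\alpha(f)=(f,h_\alpha)_{L^2}$. $H=|x|^2-\Delta$ is the harmonic oscillator on $\mathbf R^d$, so that $Hh_\alpha=(2|\alpha|+d)h_\alpha$. For $f\in L^2(\mathbf R^d)$, $H^Nf$ is the Hermite expansion $\sum_\alpha(2|\alpha|+d)^Nc_\alpha(f)h_\alpha$, and $\|H^Nf\|_{L^2}=\big(\sum_\alpha(2|\alpha|+d)^{2N}|c_\alpha(f)|^2\big)^{1/2}\in[0,\infty]$. *)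

(* Defs.v *)
From HB Require Import structures.
From mathcomp Require Import all_boot all_order all_algebra.
From mathcomp Require Import all_classical all_reals all_analysis.
From mathcomp Require Import complex.

Set Implicit Arguments.
Unset Strict Implicit.
Unset Printing Implicit Defensive.

Import Order.TTheory GRing.Theory Num.Theory.
Import numFieldNormedType.Exports.
Import ComplexField.Normc.

Local Open Scope classical_set_scope.
Local Open Scope complex_scope.
Local Open Scope ring_scope.

(* R^n as n-tuples, with the product of the Borel sigma-algebras. The library
   has no Lebesgue measure on this type. It is built below by induction on n,
   as the image of the product measure on R * R^n under (x, t) |-> x :: t; the
   recursion is on sigma-finite measures because products need them. *)
Definition Rn (R : realType) (n : nat) := n.-tuple (measurableTypeR R).

HB.instance Definition _ (R : realType) (n : nat) :=
  Measurable.on (Rn R n).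

Section lebesgue_measure_cons.
Context (R : realType) (n : nat).
Variable mu : {sigma_finite_measure set (Rn R n) -> \bar R}.

Definition consRn (xt : measurableTypeR R * Rn R n) : Rn R n.+1 :=
  [tuple of xt.1 :: xt.2].

Lemma measurable_consRn : measurable_fun [set: _] consRn.
Proof. exact: measurable_cons. Qed.

Definition lebesgue_measure_cons : set (Rn R n.+1) -> \bar R :=
  pushforward (@lebesgue_measure R \x mu)%E consRn.

Let cons0 : lebesgue_measure_cons set0 = 0%E.
Proof. by rewrite /lebesgue_measure_cons /pushforward preimage_set0 measure0. Qed.

Let cons_ge0 A : (0 <= lebesgue_measure_cons A)%E.
Proof. by rewrite /lebesgue_measure_cons /pushforward; exact: measure_ge0. Qed.

Let cons_sigma_additive : semi_sigma_additive lebesgue_measure_cons.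
Proof.
have mpre A : measurable A -> measurable (consRn @^-1` A).
  by move=> mA; rewrite -[X in measurable X]setTI; exact: measurable_consRn.
move=> F mF tF mUF; rewrite /lebesgue_measure_cons /pushforward preimage_bigcup.
apply: measure_semi_sigma_additive; first by move=> k; exact: mpre.
- apply/trivIsetP => i j _ _ ij; rewrite -preimage_setI.
  by move/trivIsetP : tF => /(_ _ _ _ _ ij) ->//; rewrite preimage_set0.
- by rewrite -preimage_bigcup; exact: mpre.
Qed.

HB.instance Definition _ := isMeasure.Build _ _ _ lebesgue_measure_cons
  cons0 cons_ge0 cons_sigma_additive.

Let cons_sigma_finite : sigma_finite [set: _] lebesgue_measure_cons.
Proof.
have /sigma_finiteP[F [TF ndF Foo]] := sigma_finiteT (@lebesgue_measure R).
have /sigma_finiteP[G [TG ndG Goo]] := sigma_finiteT mu.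
pose uncons (t : Rn R n.+1) : measurableTypeR R * Rn R n :=
  (thead t, [tuple of behead t]).
have consK : cancel consRn uncons.
  by move=> [x t]; congr pair; exact: val_inj.
have muncons : measurable_fun [set: _] uncons.
  apply/measurable_fun_pairP; split; first exact: measurable_tnth.
  exact: measurable_behead.
exists (fun k => uncons @^-1` (F k `*` G k)).
  rewrite -preimage_bigcup; apply/esym/seteqP; split => // t _ /=.
  have [i _ Fi] : (\bigcup_i F i) (thead t) by rewrite -TF.
  have [j _ Gj] : (\bigcup_j G j) [tuple of behead t] by rewrite -TG.
  exists (maxn i j) => //; split.
  - by move: Fi; exact/subsetPset/ndF/leq_maxl.
  - by move: Gj; exact/subsetPset/ndG/leq_maxr.
move=> k; have [[mF Fk] [mG Gk]] := (Foo k, Goo k); split.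
  by rewrite -[X in measurable X]setTI; apply: muncons => //; exact: measurableX.
rewrite /lebesgue_measure_cons /pushforward -comp_preimage.
rewrite (_ : uncons \o consRn = id) ?preimage_id; last exact/funext.
by rewrite product_measure1E// lte_mul_pinfty// ge0_fin_numE.
Qed.

HB.instance Definition _ := Measure_isSigmaFinite.Build _ _ _
  lebesgue_measure_cons cons_sigma_finite.

End lebesgue_measure_cons.

Fixpoint lebesgue_measure_Rn (R : realType) (n : nat) :
    {sigma_finite_measure set (Rn R n) -> \bar R} :=
  match n with
  | 0 => \d_([tuple] : Rn R 0)
  | m.+1 => lebesgue_measure_cons (lebesgue_measure_Rn R m)
  end.

Lemma lebesgue_measure_Rn_box (R : realType) (n : nat)
    (A : 'I_n -> set (measurableTypeR R)) : (forall i, measurable (A i)) ->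
  lebesgue_measure_Rn R n [set t | forall i, A i (tnth t i)] =
  (\prod_(i < n) lebesgue_measure (A i))%E.
Proof.
elim: n A => [|n IH] A mA.
  by rewrite big_ord0 /= /dirac indicE mem_set//= => -[].
rewrite big_ord_recl -(IH (fun i => A (lift ord0 i)))//= -product_measure1E//; last first.
  rewrite [X in measurable X](_ : _ = \bigcap_(i in [set: 'I_n])
      ((@tnth n _)^~ i @^-1` A (lift ord0 i))).
    apply: fin_bigcap_measurable => // i _.
    rewrite -[X in measurable X]setTI.
    exact: (@measurable_tnth _ (measurableTypeR R)).
  by apply/seteqP; split => t /=; [move=> h i _ | move=> h i]; exact: h.
rewrite /lebesgue_measure_cons /pushforward; congr (_ _).
apply/seteqP; split => -[x t] /=.
  move=> h; split => /=; first by have := h ord0; rewrite (tnth_nth x).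
  by move=> i; have := h (lift ord0 i); rewrite !(tnth_nth x).
move=> [hx ht] i; case: (unliftP ord0 i) => [j|] ->.
  by have := ht j; rewrite !(tnth_nth x).
by rewrite (tnth_nth x).
Qed.

Section hermite.
Context (R : realType).

(* The L^2-normalized Hermite functions, by Rodrigues' formula. *)
Definition hermite_fun1 (n : nat) (x : R) : R :=
  (-1) ^+ n * (2 ^+ n * n`!%:R * Num.sqrt pi) `^ (- 2^-1) *
  expR (x ^+ 2 / 2) * derive1n n (fun y : R => expR (- y ^+ 2)) x.

Context (d : nat).
Implicit Types (f g : Rn R d -> R[i]) (alpha : d.-tuple nat).

Definition midx_size alpha : nat := \sum_(i < d) tnth alpha i.

Definition midx_fact alpha : nat := \prod_(i < d) (tnth alpha i)`!.

Definition hermite_fun alpha (x : Rn R d) : R :=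
  \prod_(i < d) hermite_fun1 (tnth alpha i) (tnth x i).

Local Notation mu := (lebesgue_measure_Rn R d).

(* Elements of L^2 are represented by Borel functions; every class of almost
   everywhere equal Lebesgue-measurable functions contains one. *)
Definition L2 f : Prop :=
  [/\ measurable_fun [set: Rn R d] (fun x => complex.Re (f x)),
      measurable_fun [set: Rn R d] (fun x => complex.Im (f x)) &
      (\int[mu]_x (normc (f x) ^+ 2)%:E < +oo)%E].

Definition cintegral f : R[i] :=
  (\int[mu]_x complex.Re (f x)) +i* (\int[mu]_x complex.Im (f x)).

Definition L2_dot f g : R[i] := cintegral (fun x => f x * conjc (g x)).

Definition hermite_coef f alpha : R[i] :=
  L2_dot f (fun x => (hermite_fun alpha x)%:C).

(* The L^2-norm, possibly +oo, of the Hermite expansion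
   H^N f = \sum_alpha (2 |alpha| + d)^N c_alpha(f) h_alpha. *)
Definition harmonic_pow_norm (N : nat) f : \bar R :=
  ((\esum_(alpha in [set: d.-tuple nat])
      (((2 * midx_size alpha + d)%:R ^+ (2 * N)%N : R) *
       normc (hermite_coef f alpha) ^+ 2)%:E) `^ 2^-1)%E.

End hermite.

(* Main.v *)
Require Import Defs.
From HB Require Import structures.
From mathcomp Require Import all_boot all_order all_algebra.
From mathcomp Require Import all_classical all_reals all_analysis.
From mathcomp Require Import complex.
From mathcomp Require Import finmap ring lra.
Import Order.TTheory GRing.Theory Num.Theory.
Import ComplexField.Normc.
Local Open Scope ring_scope.

(* Put y = 2N / ln N. The bound in (2) is C 2^N r^(y/2) y^(N - y/2). With
   n = |alpha| fixed, 2^N y^(N - y/2) / (2n)^N equals n^(-n/2) when y = n, and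
   with N fixed, the supremum over m of m^N t^m m^(-m/2) is y^(N - y/2) up to a
   factor K^(y/2).
   For (2) => (1), keep a single term of the series and choose the integer N
   with n - 2 <= y <= n. For (1) => (2), bound each term by its supremum times
   2^(-n), whose sum over all multi-indices is 2^d. Since
   alpha! <= n! <= 2^(d n) alpha!, the shape of alpha is irrelevant. *)

(** * Elementary inequalities and the function 2x / ln x *)

Section real_estimates.
Context {R : realType}.
Implicit Types (x s t m : R) (n N : nat).

Lemma ln_le_subr1 x : 0 < x -> ln x <= x - 1.
Proof.
move=> x0; rewrite -{1}(subrK 1 x) addrC; apply: le_ln1Dx; lra.
Qed.

Lemma expR_ge_halfsqr s : 0 <= s -> 1 + s ^+ 2 / 2 <= expR s.
Proof. exact: (@expR_ge1Dxn R s 1). Qed.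

Lemma half_le_ln2 : 2^-1 <= ln 2 :> R.
Proof.
have := @ln_le_subr1 2^-1; rewrite lnV ?posrE; last lra.
by move=> /(_ ltac:(lra)); lra.
Qed.

Definition twice_div_ln x : R := 2 * x / ln x.

(** The last clause isolates ln (ln x / 2), the gap between ln x and ln y that [power_ratio_le] has
    to absorb. *)
Lemma twice_div_lnP x : 2 <= x ->
  [/\ 2^-1 <= ln x, ln x <= x, 0 < twice_div_ln x,
      twice_div_ln x * ln x = 2 * x &
      ln (twice_div_ln x) = ln x - ln (ln x / 2)].
Proof.
move=> x2.
have Lh : 2^-1 <= ln x.
  by apply: le_trans half_le_ln2 _; rewrite ler_ln ?posrE//; lra.
have Lx : ln x <= x by have := @ln_le_subr1 x ltac:(lra); lra.
have L0 : 0 < ln x by lra.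
have y0 : 0 < twice_div_ln x.
  by rewrite /twice_div_ln; apply: divr_gt0 => //; lra.
split => //; first by rewrite /twice_div_ln divfK// gt_eqF.
rewrite /twice_div_ln.
have -> : 2 * x / ln x = x / (ln x / 2).
  by field; rewrite gt_eqF.
by rewrite ln_div ?posrE; lra.
Qed.

(** Write L = ln x, y = 2x / L, A = ln y and B = ln (L / 2). As L <= x, y >= 2 and A >= 1 - 1/y >=
    1/2. If L >= 2, then e^B >= 1 + B^2 / 2 gives B^2 <= L - 2, while A = L - B >= L/2 + 1. If L <
    2, then -3 <= B <= 0, so B^2 <= 9 <= 18 A; this is the source of 18. *)
Lemma ln_twice_div_ln_ge x : 2 <= x ->
  2^-1 <= ln (twice_div_ln x) /\
  ln (ln x / 2) ^+ 2 <= 18 * ln (twice_div_ln x).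
Proof.
move=> x2; have [Lh Lx y0 yL lny] := twice_div_lnP _ x2.
have L0 : 0 < ln x by lra.
have Ah : 2^-1 <= ln (twice_div_ln x).
  have := @ln_le_subr1 (twice_div_ln x)^-1.
  rewrite invr_gt0 lnV ?posrE// => /(_ y0).
  suff : (twice_div_ln x)^-1 <= 2^-1 by lra.
  rewrite lef_pV2 ?posrE//; nra.
split => //.
have [L2|L2] := leP 2 (ln x).
  have B0 : 0 <= ln (ln x / 2) by apply: ln_ge0; lra.
  have := expR_ge_halfsqr _ B0; rewrite lnK ?posrE; last lra.
  have := @ln_le_subr1 (ln x / 2) ltac:(lra).
  lra.
have B0 : ln (ln x / 2) <= 0 by apply: ln_le0; lra.
have B3 : - 3 <= ln (ln x / 2).
  have := @ln_le_subr1 (ln x / 2)^-1.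
  rewrite invr_gt0 lnV ?posrE; [|lra..].
  move=> /(_ ltac:(lra)).
  suff : (ln x / 2)^-1 <= 4 by lra.
  by rewrite -[leRHS]invrK lef_pV2 ?posrE; lra.
nra.
Qed.

(* Use ln u <= u - 1 at both u = A z / L and u = L / A. *)
Lemma max_power_ratio (A L z : R) : 0 < A -> 0 < L -> 0 < z ->
  L * ln z - A * z + A <= (L - A) ^+ 2 / A.
Proof.
move=> A0 L0 z0.
have h1 := @ln_le_subr1 (A * z / L) ltac:(by rewrite divr_gt0// mulr_gt0).
have h2 := @ln_le_subr1 (L / A) ltac:(by rewrite divr_gt0).
move: h1 h2; rewrite !ln_div ?lnM ?posrE ?mulr_gt0// => h1 h2.
have h3 : L * ln z <= L * (A * z / L - 1) + L * (L / A - 1).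
  by rewrite -mulrDr ler_pM2l//; lra.
apply: le_trans (_ : L * (A * z / L - 1) + L * (L / A - 1) - A * z + A <= _).
  lra.
rewrite le_eqVlt; apply/orP; left; apply/eqP; field.
by rewrite !gt_eqF.
Qed.

(* With y = 2x / ln x, A = ln y and m = y z, dividing the difference of the two
   sides by y/2 leaves [L ln z - A z + A] + [z (2 ln t - ln z)], L = ln x; the
   brackets are at most (L - A)^2 / A <= 18 and t^2. *)
Lemma power_ratio_le x m t : 2 <= x -> 0 < m -> 0 < t ->
  x * ln m + m * ln t - m / 2 * ln m <=
  twice_div_ln x / 2 * (18 + t ^+ 2) +
  (x - twice_div_ln x / 2) * ln (twice_div_ln x).
Proof.
move=> x2 m0 t0.
have [Lh Lx y0 yL lny] := twice_div_lnP _ x2.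
have [Ah BA] := ln_twice_div_ln_ge _ x2.
set y := twice_div_ln x in y0 yL lny Ah BA *.
set A := ln y in lny Ah BA *; set B := ln (ln x / 2) in lny BA.
set L := ln x in Lh Lx yL lny *.
pose z := m / y; have z0 : 0 < z by rewrite divr_gt0.
have mE : m = y * z by rewrite mulrC divfK// gt_eqF.
have lnm : ln m = A + ln z by rewrite mE lnM.
have h1 : L * ln z - A * z + A <= 18.
  have A0 : 0 < A by apply: lt_le_trans Ah; lra.
  have L0 : 0 < L by apply: lt_le_trans Lh; lra.
  apply: le_trans (@max_power_ratio A L z A0 L0 z0) _.
  have -> : L - A = B by rewrite lny opprB addrC subrK.
  rewrite ler_pdivrMr //; lra.
have h2 : z * (2 * ln t - ln z) <= t ^+ 2.
  have : 0 < t ^+ 2 / z by rewrite divr_gt0// exprn_gt0.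
  move=> /ln_le_subr1; rewrite ln_div ?posrE ?exprn_gt0// lnXn// => h.
  apply: le_trans (_ : z * (t ^+ 2 / z - 1) <= _).
    rewrite ler_pM2l//; lra.
  rewrite mulrBr mulrCA divff ?gt_eqF//; lra.
have h3 : y / 2 * (L * ln z - A * z + A + z * (2 * ln t - ln z)) <=
   y / 2 * (18 + t ^+ 2).
  rewrite ler_pM2l; lra.
have xE : x = y * L / 2 by lra.
rewrite lnm mE xE; lra.
Qed.

(** For n >= 4 one has ln n >= 1, so keeping the denominator ln n costs 2 / ln n <= 2. Thus y cannot
    jump upwards over an interval of length 2. *)
Lemma twice_div_ln_step n : (4 <= n)%N ->
  twice_div_ln n.+1%:R <= twice_div_ln n%:R + 2.
Proof.
move=> n4.
have n4R : 4 <= n%:R :> R by rewrite (ler_nat R 4).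
have L1 : 1 <= ln n%:R :> R.
  apply: le_trans (_ : ln (2 ^+ 2) <= _).
    by rewrite lnXn//; have := half_le_ln2; lra.
  by rewrite ler_ln ?posrE; lra.
have L2 : ln n%:R <= ln n.+1%:R :> R.
  by rewrite ler_ln ?posrE// -?natr1; lra.
apply: le_trans (_ : 2 * n.+1%:R / ln n%:R <= _).
  rewrite /twice_div_ln ler_pM2l; last by rewrite mulr_gt0.
  by rewrite lef_pV2 ?posrE; lra.
rewrite -(natr1 n) /twice_div_ln mulrDr mulrDl lerD2l ler_pdivrMr; lra.
Qed.

Lemma ln_le_twice_div_ln x : 2 <= x -> ln x <= twice_div_ln x.
Proof.
move=> x2; have [Lh _ _ _ _] := twice_div_lnP _ x2.
rewrite /twice_div_ln ler_pdivlMr; last lra.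
have := @expR_ge_halfsqr (ln x) ltac:(lra); rewrite lnK ?posrE; lra.
Qed.

(* The threshold 8 comes from 8 / ln 4 <= 8, the value at N = 4. *)
Lemma exists_twice_div_ln n : (8 <= n)%N ->
  exists2 N, (4 <= N)%N & (n%:R - 2 <= twice_div_ln N%:R <= n%:R).
Proof.
move=> n8; have n8R : 8 <= n%:R :> R by rewrite (ler_nat R 8).
(* The least such N works: n < y(N + 1) <= y(N) + 2 gives the lower bound, and minimality gives the
   upper one unless N = 4. Such an N exists because y(x) >= ln x exceeds n once x > e^n. *)
pose P N := (4 <= N)%N && (n%:R < twice_div_ln N.+1%:R :> R).
have exP : exists N, P N.
  pose M := (Num.truncn (expR n%:R : R)).
  have MP : expR n%:R < M.+1%:R :> R by exact: truncnS_gt.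
  exists (maxn 4 M); rewrite /P leq_maxl/=.
  have le2 : 2 <= (maxn 4 M).+1%:R :> R.
    by rewrite (ler_nat R 2) ltnS (leq_trans _ (leq_maxl _ _)).
  apply: lt_le_trans (@ln_le_twice_div_ln _ le2).
  rewrite -(expRK n%:R) ltr_ln ?posrE ?expR_gt0//.
  by apply: lt_le_trans MP _; rewrite ler_nat ltnS leq_maxr.
have [N /andP[N4 ltN] minN] := ex_minnP exP; exists N => //.
have step := @twice_div_ln_step N N4.
apply/andP; split; first lra.
move: N4; rewrite leq_eqVlt => /predU1P[<-|N5].
  have ln4 : 1 <= ln 4 :> R.
    rewrite (_ : 4 = 2 ^+ 2); last ring.
    by rewrite lnXn//; have := half_le_ln2; lra.
  by rewrite /twice_div_ln ler_pdivrMr; nra.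
have [//|lt] := leP (twice_div_ln N%:R) (n%:R : R).
have N0 : (0 < N)%N by exact: ltn_trans N5.
have := minN N.-1; rewrite /P prednK// lt -ltnS prednK// N5 => /(_ isT).
by rewrite -ltnS prednK// ltnn.
Qed.

(** * Factorials on the logarithmic scale, and the choice of N *)

Lemma exprnn_le_fact n : n%:R ^+ n <= expR 1 ^+ n * n`!%:R :> R.
Proof.
rewrite -expRM_natr mul1r -ler_pdivrMr ?ltr0n ?fact_gt0//.
case: n => [|n]; first by rewrite expr0 fact0 divr1 expR0.
by apply: le_trans (expR_ge1Dxn n _); rewrite ?lerDr.
Qed.

Lemma ln_fact_ge n : n%:R * ln n%:R - n%:R <= ln n`!%:R :> R.
Proof.
case: n => [|n]; first by rewrite mul0r subr0 ln1.
have := exprnn_le_fact n.+1.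
rewrite -ler_ln ?posrE ?mulr_gt0 ?exprn_gt0 ?expR_gt0 ?ltr0n ?fact_gt0//.
rewrite lnM ?posrE ?exprn_gt0 ?expR_gt0 ?ltr0n ?fact_gt0//.
by rewrite !lnXn ?expR_gt0// expRK !mulr_natl; lra.
Qed.

(** With [ln_fact_ge], this gives ln n! = n ln n + O(n); errors of order n only change the constant
    r. *)
Lemma ln_fact_le n : ln n`!%:R <= n%:R * ln n%:R :> R.
Proof.
elim: n => [|n IHn]; first by rewrite mul0r ln1.
rewrite factS natrM lnM ?posrE ?ltr0n ?fact_gt0// [leRHS]mulr_natl [leRHS]mulrS.
rewrite lerD2l (le_trans IHn)// -[leRHS]mulr_natl.
case: n {IHn} => [|n]; first by rewrite !mul0r.
by rewrite ler_wpM2l// ler_ln ?posrE// ler_nat.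
Qed.

(** Since n - 2 <= y <= n, y ln y >= (n - 2) ln (n - 2) >= ln (n - 2)! >= ln n! - 2 ln n. Half of
    the loss 2 ln n is at most n, hence rho + 1 in place of rho. *)
Lemma exists_decay_exponent n (rho : R) : (8 <= n)%N -> 0 <= rho ->
  exists2 N, (4 <= N)%N &
    twice_div_ln N%:R / 2 * rho +
    (N%:R - twice_div_ln N%:R / 2) * ln (twice_div_ln N%:R) <=
    N%:R * ln n%:R + n%:R * (rho + 1) - ln n`!%:R / 2.
Proof.
move=> n8 rho0; have [N N4 /andP[yge yle]] := exists_twice_div_ln _ n8.
exists N => //; set y := twice_div_ln _ in yge yle *.
have N0 : 0 <= N%:R :> R by [].
case: n n8 yge yle => [//|[//|k]]; rewrite !ltnS => k6 yge yle.
have n2 : k.+2%:R = k%:R + 2 :> R by rewrite -addn2 natrD.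
have k6R : 6 <= k%:R :> R by rewrite (ler_nat R 6).
rewrite n2 addrK in yge.
have lk0 : 0 <= ln k%:R :> R by apply: ln_ge0; lra.
have lny : ln k%:R <= ln y by rewrite ler_ln ?posrE; lra.
have lnyn : ln y <= ln k.+2%:R by rewrite ler_ln ?posrE// ?n2; lra.
have hk : k%:R * ln k%:R <= y * ln y by apply: ler_pM; lra.
have hf : ln k.+2`!%:R <= 2 * ln k.+2%:R + ln k`!%:R :> R.
  rewrite !factS !natrM !lnM ?posrE ?mulr_gt0 ?ltr0n ?fact_gt0//.
  have : ln k.+1%:R <= ln k.+2%:R :> R by rewrite ler_ln ?posrE// ler_nat.
  by lra.
have hn := @ln_le_subr1 k.+2%:R (ltr0Sn _ _).
have hfk := ln_fact_le k.
have hN : N%:R * ln y <= N%:R * ln k.+2%:R by apply: ler_wpM2l.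
have hrho : y / 2 * rho <= k.+2%:R * rho by apply: ler_wpM2r => //; lra.
lra.
Qed.

(** In this form bounds are compared through their exponents, and r enters only as ln r times y/2:
    any constant multiplying y/2 can be absorbed in r. *)
Lemma rate_expR (C r : R) N : 0 < r -> (2 <= N)%N ->
  C * 2 ^+ N * r `^ (N%:R / ln N%:R) *
    (2 * N%:R / ln N%:R) `^ (N%:R * (1 - (ln N%:R)^-1)) =
  C * 2 ^+ N * expR (twice_div_ln N%:R / 2 * ln r +
    (N%:R - twice_div_ln N%:R / 2) * ln (twice_div_ln N%:R)).
Proof.
move=> r0 N2; have N2R : 2 <= N%:R :> R by rewrite (ler_nat R 2).
have [Lh _ y0 _ _] := twice_div_lnP _ N2R.
rewrite -mulrA expRD; congr (_ * (_ * _)).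
  rewrite /powR gt_eqF//; congr (expR (_ * _)).
  by rewrite /twice_div_ln; field; rewrite gt_eqF//; lra.
rewrite -/(twice_div_ln _) /powR gt_eqF//; congr (expR (_ * _)).
by rewrite /twice_div_ln; field; rewrite gt_eqF//; lra.
Qed.

(** * A geometric sum over multi-indices *)

Lemma sum_half_pow n : \sum_(i < n) (2^-1 : R) ^+ i <= 2.
Proof.
suff -> : \sum_(i < n) (2^-1 : R) ^+ i = 2 - 2 * 2^-1 ^+ n.
  by rewrite gerBl mulr_ge0// exprn_ge0.
elim: n => [|n IHn]; first by rewrite big_ord0 expr0; lra.
by rewrite big_ord_recr/= IHn exprS; lra.
Qed.

(** Finitely many multi-indices lie in a box {0, ..., M}^d, and the sum over the box factors into d
    geometric sums, each at most 2. *)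
Lemma sum_half_pow_midx_size d (s : seq (d.-tuple nat)) : uniq s ->
  \sum_(alpha <- s) (2^-1 : R) ^+ midx_size alpha <= 2 ^+ d.
Proof.
move=> us; pose M := \max_(alpha <- s) midx_size alpha.
have lesM alpha i : alpha \in s -> (tnth alpha i < M.+1)%N.
  move=> sa; rewrite ltnS (@leq_trans (midx_size alpha))//.
    by rewrite /midx_size (bigD1 i)//= leq_addr.
  exact: leq_bigmax_seq.
pose phi (alpha : d.-tuple nat) : {ffun 'I_d -> 'I_M.+1} :=
  [ffun i => inord (tnth alpha i)].
pose g (f : {ffun 'I_d -> 'I_M.+1}) : R := \prod_i 2^-1 ^+ f i.
have g0 f : 0 <= g f by apply: prodr_ge0 => i _; rewrite exprn_ge0.
have -> : \sum_(alpha <- s) (2^-1 : R) ^+ midx_size alpha =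
    \sum_(f <- map phi s) g f.
  rewrite big_map big_seq [RHS]big_seq; apply: eq_bigr => alpha sa.
  rewrite /midx_size expr_sum; apply: eq_bigr => i _.
  by rewrite ffunE inordK// lesM.
rewrite big_uniq/=; last first.
  rewrite map_inj_in_uniq// => a b sa sb /ffunP ab; apply: eq_from_tnth => i.
  by have /(congr1 val) := ab i; rewrite !ffunE /= !inordK// lesM.
apply: le_trans (_ : \sum_f g f <= _).
  by rewrite big_mkcond; apply: ler_sum => f _; case: ifP.
rewrite -(bigA_distr_bigA (fun (i : 'I_d) (j : 'I_M.+1) => (2^-1 : R) ^+ j)).
rewrite (le_trans (_ : _ <= \prod_(i < d) (2 : R)))//; last first.
  by rewrite prodr_const card_ord.
apply: ler_prod => i _; rewrite sum_half_pow andbT.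
by apply: sumr_ge0 => j _; rewrite exprn_ge0.
Qed.

End real_estimates.

(** * Comparison of alpha! with |alpha|! *)

Lemma bin_le_exp2 n m : ('C(n, m) <= 2 ^ n)%N.
Proof.
elim: n m => [|n IHn] [|m]; rewrite ?bin0 ?expn_gt0//.
by rewrite binS expnS mul2n -addnn leq_add.
Qed.

Lemma fact_addn_ge m n : (m`! * n`! <= (m + n)`!)%N.
Proof.
rewrite -(@bin_fact (m + n) m) ?leq_addr// addKn.
by rewrite leq_pmull// bin_gt0 leq_addr.
Qed.

Lemma fact_addn_le m n : ((m + n)`! <= 2 ^ (m + n) * (m`! * n`!))%N.
Proof.
rewrite -(@bin_fact (m + n) m) ?leq_addr// addKn.
by rewrite leq_mul2r bin_le_exp2 orbT.
Qed.

Lemma midx_fact_gt0 d (alpha : d.-tuple nat) : (0 < midx_fact alpha)%N.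
Proof. by apply: prodn_gt0 => i; exact: fact_gt0. Qed.

Lemma midx_fact_le d (alpha : d.-tuple nat) :
  (midx_fact alpha <= (midx_size alpha)`!)%N.
Proof.
rewrite /midx_fact /midx_size.
elim/big_rec2 : _ => // i m n _ le; rewrite (leq_trans _ (fact_addn_ge _ _))//.
by rewrite leq_mul2l le orbT.
Qed.

(** Coordinates are split off one at a time; each split costs a binomial coefficient, at most
    2^|alpha|. *)
Lemma midx_fact_ge d (alpha : d.-tuple nat) :
  ((midx_size alpha)`! <= 2 ^ (d * midx_size alpha) * midx_fact alpha)%N.
Proof.
rewrite /midx_fact /midx_size.
move: (tnth alpha) => {alpha} F; elim: d F => [|d IHd] F; first by rewrite !big_ord0.
rewrite !big_ord_recl; set m := F ord0.
have := IHd (fun i => F (lift ord0 i)).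
set n := (\sum_(i < d) _)%N; set p := (\prod_(i < d) _)%N => le.
apply: leq_trans (fact_addn_le _ _) _.
rewrite [in leqRHS]mulSn [in leqRHS]expnD -[in leqRHS]mulnA leq_mul2l; apply/orP; right.
apply: leq_trans (_ : m`! * (2 ^ (d * n) * p) <= _)%N.
  by rewrite leq_mul2l le orbT.
by rewrite mulnCA leq_mul2r leq_exp2l// leq_mul2l leq_addl !orbT.
Qed.

Lemma normc_ge0 (R : rcfType) (z : R[i]) : 0 <= normc z.
Proof. by case: z => *; exact: sqrtr_ge0. Qed.

(** * Bounds on the terms and the sum of the Hermite series *)

Section hermite_expansion.
Context {R : realType} {d : nat}.
Implicit Types (a : d.-tuple nat -> R) (alpha : d.-tuple nat) (N : nat).

(** The left side is the logarithm of (|alpha| + d)^N r^|alpha| (alpha!)^(-1/2) with rho = ln r. The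
    final ln 2 term is the factor 2^(-|alpha|/2) that makes the series summable. *)
Lemma growth_exponent_le (rho : R) N alpha : (0 < d)%N -> 0 <= rho ->
    (2 <= N)%N ->
  N%:R * ln (midx_size alpha + d)%:R + (midx_size alpha)%:R * rho -
    ln (midx_fact alpha)%:R / 2 <=
  twice_div_ln N%:R / 2 * (18 + expR (rho + d%:R + 2) ^+ 2) +
  (N%:R - twice_div_ln N%:R / 2) * ln (twice_div_ln N%:R) +
  ln d`!%:R / 2 - (midx_size alpha)%:R / 2 * ln 2.
Proof.
move=> d0 rho0 N2; have N2R : 2 <= N%:R :> R by rewrite (ler_nat R 2).
set n := midx_size alpha; pose m := (n + d)%N.
have m0 : 0 < m%:R :> R by rewrite ltr0n addn_gt0 d0 orbT.
(* The d + 2 in t pays for every error linear in m: replacing alpha! by m! and m! by m^m, and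
   gaining 2^(-n/2). *)
have := @power_ratio_le R N%:R m%:R (expR (rho + d%:R + 2)) N2R m0 (expR_gt0 _).
rewrite expRK -/m.
have F1 : ln n`!%:R <= d%:R * n%:R * ln 2 + ln (midx_fact alpha)%:R :> R.
  have := midx_fact_ge _ alpha; rewrite -(ler_nat R) natrM natrX.
  rewrite -[X in is_true X -> _]ler_ln ?posrE ?mulr_gt0 ?exprn_gt0 ?ltr0n ?fact_gt0 ?midx_fact_gt0//.
  rewrite lnM ?posrE ?exprn_gt0 ?ltr0n ?midx_fact_gt0//.
  by rewrite lnXn// -[ln 2 *+ _]mulr_natl natrM.
have F2 : ln m`!%:R <= m%:R * ln 2 + ln n`!%:R + ln d`!%:R :> R.
  have := fact_addn_le n d; rewrite -(ler_nat R) !natrM natrX.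
  rewrite -[X in is_true X -> _]ler_ln ?posrE ?mulr_gt0 ?exprn_gt0 ?ltr0n ?fact_gt0//.
  rewrite !lnM ?posrE ?mulr_gt0 ?exprn_gt0 ?ltr0n ?fact_gt0//.
  by rewrite lnXn// -[ln 2 *+ _]mulr_natl addrA.
have F3 := @ln_fact_ge R m.
have l2 : ln 2 <= 1 :> R by have := @ln_le_subr1 R 2 ltac:(lra); lra.
have l20 := @half_le_ln2 R.
have nm : n%:R <= m%:R :> R by rewrite ler_nat leq_addr.
have n0 : 0 <= n%:R :> R by [].
have d0R : 0 <= d%:R :> R by [].
have h1 : n%:R * rho <= m%:R * rho by exact: ler_wpM2r.
have h2 : d%:R * n%:R * ln 2 <= m%:R * d%:R :> R.
  apply: le_trans (_ : d%:R * n%:R <= _); first by rewrite ler_piMr// mulr_ge0.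
  by rewrite [leLHS]mulrC ler_wpM2r.
have h3 : m%:R * ln 2 <= m%:R :> R by rewrite ler_piMr// ltW.
have h4 : n%:R * ln 2 <= m%:R :> R by apply: le_trans nm; rewrite ler_piMr.
have h5 : 0 <= m%:R * d%:R :> R by rewrite mulr_ge0// ltW.
lra.
Qed.

(** Bound 2|alpha| + d by 2(|alpha| + d), exponentiate [growth_exponent_le], and square. *)
Lemma coef_term_le a (C r : R) N alpha : (0 < d)%N -> 0 < C -> 1 <= r ->
    (2 <= N)%N -> 0 <= a alpha ->
    a alpha <= C * r ^+ midx_size alpha * (midx_fact alpha)%:R `^ (- 2^-1) ->
  (2 * midx_size alpha + d)%:R ^+ (2 * N) * a alpha ^+ 2 <=
  2^-1 ^+ midx_size alpha *
  (expR (ln d`!%:R / 2) * C * 2 ^+ N * expR (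
    twice_div_ln N%:R / 2 * (18 + expR (ln r + d%:R + 2) ^+ 2) +
    (N%:R - twice_div_ln N%:R / 2) * ln (twice_div_ln N%:R))) ^+ 2.
Proof.
move=> d0 C0 r1 N2 a0 le.
have r0 : 0 < r by lra.
have := growth_exponent_le (ln r) N alpha d0 (ln_ge0 r1) N2.
set n := midx_size alpha in le *; set E := (X in X + ln d`!%:R / 2) => ex.
have m0 : 0 < (n + d)%:R :> R by rewrite ltr0n addn_gt0 d0 orbT.
have -> : (2^-1 : R) ^+ n = expR (- (n%:R / 2 * ln 2)) ^+ 2.
  rewrite -expRM_natr (_ : _ * 2%:R = n%:R * ln 2^-1); last first.
    by rewrite lnV ?posrE//; lra.
  by rewrite expRM_natl lnK ?posrE// invr_gt0.
rewrite (mulnC 2 N) exprM -!exprMn.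
rewrite ler_sqr ?nnegrE ?mulr_ge0 ?exprn_ge0 ?expR_ge0//; last exact: ltW.
apply: le_trans (_ : (2 ^+ N * (n + d)%:R ^+ N) *
   (C * r ^+ n * (midx_fact alpha)%:R `^ (- 2^-1)) <= _).
  apply: ler_pM => //.
  rewrite -exprMn lerXn2r ?nnegrE ?mulr_ge0//.
  by rewrite -natrM ler_nat mulnDr leq_add2l leq_pmull.
have -> : (2 ^+ N * (n + d)%:R ^+ N) *
   (C * r ^+ n * (midx_fact alpha)%:R `^ (- 2^-1)) =
   C * 2 ^+ N * expR (N%:R * ln (n + d)%:R + n%:R * ln r -
      ln (midx_fact alpha)%:R / 2).
  rewrite !expRD !expRM_natl !lnK ?posrE//.
  rewrite /powR gt_eqF ?ltr0n ?midx_fact_gt0//.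
  have -> : - 2^-1 * ln (midx_fact alpha)%:R = - (ln (midx_fact alpha)%:R / 2) :> R.
    by rewrite mulNr mulrC.
  ring.
have -> : expR (- (n%:R / 2 * ln 2)) *
  (expR (ln d`!%:R / 2) * C * 2 ^+ N * expR E) =
  C * 2 ^+ N * expR (E + ln d`!%:R / 2 - n%:R / 2 * ln 2) :> R.
  rewrite !expRD; ring.
by rewrite ler_pM2l ?mulr_gt0 ?exprn_gt0// ler_expR.
Qed.

Lemma esum_half_pow_le (a : d.-tuple nat -> R) (G : R) : 0 <= G ->
  (forall alpha, 0 <= a alpha <= 2^-1 ^+ midx_size alpha * G ^+ 2) ->
  ((\esum_(alpha in [set: d.-tuple nat]) (a alpha)%:E) `^ 2^-1 <=
   (2 ^+ d * G)%:E)%E.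
Proof.
move=> G0 aG.
have le : (\esum_(alpha in [set: d.-tuple nat]) (a alpha)%:E <=
    ((2 ^+ d * G) ^+ 2)%:E)%E.
  apply: ge_ereal_sup => _ [X [finX _] <-].
  rewrite fsbig_finite//= sumEFin lee_fin.
  have : \sum_(alpha <- fset_set X) a alpha <=
      \sum_(alpha <- fset_set X) 2^-1 ^+ midx_size alpha * G ^+ 2.
    by apply: ler_sum => alpha _; have /andP[] := aG alpha.
  move=> /le_trans; apply; rewrite -mulr_suml exprMn ler_wpM2r ?exprn_ge0//.
  apply: le_trans (sum_half_pow_midx_size _ _ (fset_uniq _)) _.
  (* 2^d is weakened to 2^(2d), so that the square root is again an integer power. *)
  by rewrite -exprM ler_eXn2l ?ltr1n// leq_pmulr.
have G1 : 0 <= 2 ^+ d * G by rewrite mulr_ge0// exprn_ge0.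
have -> : (2 ^+ d * G)%:E = (((2 ^+ d * G) ^+ 2)%:E `^ 2^-1)%E.
  by rewrite poweR_EFin powR12_sqrt ?sqr_ge0// sqrtr_sqr ger0_norm.
apply: gt0_ler_poweR => //.
  rewrite in_itv/= leey andbT; apply: esum_ge0 => alpha _.
  by rewrite lee_fin; have /andP[] := aG alpha.
by rewrite in_itv/= leey andbT lee_fin sqr_ge0.
Qed.

Lemma harmonic_pow_norm_ge (f : Rn R d -> R[i]) N alpha :
  (((2 * midx_size alpha + d)%:R ^+ N * normc (hermite_coef f alpha))%:E <=
   harmonic_pow_norm N f)%E.
Proof.
set x := _ * _; have x0 : 0 <= x by rewrite mulr_ge0 ?exprn_ge0 ?normc_ge0.
have -> : x%:E = ((x ^+ 2)%:E `^ 2^-1)%E.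
  by rewrite poweR_EFin powR12_sqrt ?sqr_ge0// sqrtr_sqr ger0_norm.
have pos beta : (0 <= (((2 * midx_size beta + d)%:R ^+ (2 * N)%N : R) *
       normc (hermite_coef f beta) ^+ 2)%:E)%E.
  by rewrite lee_fin mulr_ge0 ?sqr_ge0 ?exprn_ge0.
apply: gt0_ler_poweR => //.
- by rewrite in_itv/= leey andbT lee_fin sqr_ge0.
- by rewrite in_itv/= leey andbT; apply: esum_ge0 => beta _.
apply: esum_ge; exists [set alpha]%classic; first by split.
by rewrite fsbig_set1 exprMn -exprM (mulnC N 2).
Qed.

End hermite_expansion.

Theorem theorem1 (R : realType) (d : nat) (d_gt0 : (0 < d)%N)
    (f : Rn R d -> R[i]) (f_L2 : L2 f) :
  (exists r C : R, [/\ 0 < r, 0 < C &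
     forall alpha : d.-tuple nat,
       normc (hermite_coef f alpha) <=
       C * r ^+ midx_size alpha * ((midx_fact alpha)%:R : R) `^ (- 2^-1)])
  <->
  (exists r C : R, [/\ 0 < r, 0 < C &
     forall N : nat, (2 <= N)%N ->
       (harmonic_pow_norm N f <=
        (C * 2 ^+ N * r `^ (N%:R / ln N%:R) *
         (2 * N%:R / ln N%:R) `^ (N%:R * (1 - (ln N%:R)^-1)))%:E)%E]).
Proof.
split=> [[r [C [r0 C0 le]]]|[r [C [r0 C0 le]]]].
  (* Raising r to at least 1 only weakens (1) and makes ln r nonnegative. *)
  pose r1 := Num.max 1 r.
  have r1_ge1 : 1 <= r1 by rewrite le_max lexx.
  have r_r1 : r <= r1 by rewrite le_max lexx orbT.
  pose K := expR (ln d`!%:R / 2) * C.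
  have K0 : 0 < K by rewrite mulr_gt0// expR_gt0.
  (* The exponent is the coefficient of y/2 in [coef_term_le]; 2^d comes from the summation. *)
  exists (expR (18 + expR (ln r1 + d%:R + 2) ^+ 2)), (2 ^+ d * K); split.
  - exact: expR_gt0.
  - by rewrite mulr_gt0// exprn_gt0.
  move=> N N2; rewrite rate_expR ?expR_gt0// expRK -[X in X%:E]mulrA -mulrA.
  apply: esum_half_pow_le => [|alpha].
    by rewrite !mulr_ge0 ?exprn_ge0 ?expR_ge0// ltW.
  apply/andP; split.
    by rewrite mulr_ge0 ?sqr_ge0 ?exprn_ge0.
  rewrite mulrA.
  apply: (coef_term_le (fun beta => normc (hermite_coef f beta))) => //.
    exact: normc_ge0.
  apply: le_trans (le alpha) _.
  rewrite ler_wpM2r ?powR_ge0// ler_pM2l// lerXn2r// nnegrE ltW//.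
  exact: lt_le_trans r_r1.
pose r1 := Num.max 1 r.
have r1_ge1 : 1 <= r1 by rewrite le_max lexx.
have r1_gt0 : 0 < r1 by exact: lt_le_trans r1_ge1.
have r_r1 : ln r <= ln r1 by rewrite ler_ln ?posrE// le_max lexx orbT.
have bound N alpha : (2 <= N)%N ->
    (2 * midx_size alpha + d)%:R ^+ N * normc (hermite_coef f alpha) <=
    C * 2 ^+ N * expR (twice_div_ln N%:R / 2 * ln r1 +
      (N%:R - twice_div_ln N%:R / 2) * ln (twice_div_ln N%:R)).
  move=> N2; rewrite -lee_fin.
  apply: le_trans (harmonic_pow_norm_ge f N alpha) _.
  apply: le_trans (le _ N2) _; rewrite rate_expR// lee_fin.
  rewrite ler_pM2l ?mulr_gt0 ?exprn_gt0// ler_expR lerD2r ler_wpM2l//.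
  have [] := @twice_div_lnP R N%:R; first by rewrite (ler_nat R 2).
  by move=> _ _ /ltW ? _ _; rewrite divr_ge0.
pose D : R := C * 2 ^+ 2 * expR (twice_div_ln 2%:R / 2 * ln r1 +
  (2%:R - twice_div_ln 2%:R / 2) * ln (twice_div_ln 2%:R)).
have D0 : 0 < D by rewrite !mulr_gt0 ?exprn_gt0 ?expR_gt0.
(* C serves |alpha| >= 8 and D e^32 the smaller ones, where (ln n!) / 2 <= 64 / 2 = 32. *)
exists (expR (ln r1 + 1)), (C + D * expR 32); split.
- exact: expR_gt0.
- by rewrite addr_gt0// mulr_gt0// expR_gt0.
move=> alpha; set n := midx_size alpha; set a := normc _.
have a0 : 0 <= a by exact: normc_ge0.
have F0 : 0 < (midx_fact alpha)%:R :> R by rewrite ltr0n midx_fact_gt0.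
have Fn : ln (midx_fact alpha)%:R <= ln n`!%:R :> R.
  by rewrite ler_ln ?posrE ?ltr0n ?fact_gt0 ?midx_fact_gt0// ler_nat midx_fact_le.
have -> : (midx_fact alpha)%:R `^ (- 2^-1) =
    expR (- (ln (midx_fact alpha)%:R / 2)) :> R.
  by rewrite /powR gt_eqF// mulNr mulrC.
rewrite -expRM_natl -mulrA -expRD.
have [n8|n8] := ltnP n 8.
  (* ln n! <= n^2 <= 64 here, so N = 2 suffices. *)
  have aD : a <= D.
    apply: le_trans (bound 2 alpha isT); rewrite ler_peMl// exprn_ege1//.
    by rewrite (ler_nat R 1) addn_gt0 d_gt0 orbT.
  apply: le_trans (_ : (D * expR 32) * expR (- 32) <= _).
    by rewrite expRN mulfK// gt_eqF// expR_gt0.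
  have D32 : 0 <= D * expR 32 by rewrite ltW// mulr_gt0// expR_gt0.
  apply: ler_pM; rewrite ?expR_ge0//.
    by rewrite lerDr ltW.
  rewrite ler_expR.
  have h1 : 0 <= n%:R * (ln r1 + 1) by rewrite mulr_ge0// addr_ge0// ln_ge0.
  have n8R : n%:R <= 8 :> R by rewrite (ler_nat R n 8) ltnW.
  have h2 : ln n`!%:R <= n%:R * n%:R :> R.
    apply: le_trans (ln_fact_le n) _; rewrite ler_wpM2l//.
    (* At n = 0, [ln] takes its default value 0. *)
    have [->|n_gt0] := posnP n; first by rewrite ln0.
    by rewrite ltW// ln_sublinear// ltr0n.
  have h3 : n%:R * n%:R <= 8 * 8 :> R by rewrite ler_pM.
  lra.
have [N N4 hN] := @exists_decay_exponent R n (ln r1) n8 (ln_ge0 r1_ge1).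
have n0 : 0 < n%:R :> R by rewrite ltr0n (leq_trans _ n8).
have nN0 : 0 < (2 * n%:R) ^+ N :> R by rewrite exprn_gt0// mulr_gt0.
(* [exists_decay_exponent] compares with (2n)^N, which is at most the factor (2n + d)^N in
   [bound]. *)
rewrite -(ler_pM2l nN0).
apply: le_trans (_ : (2 * n + d)%:R ^+ N * a <= _).
  rewrite ler_wpM2r// lerXn2r ?nnegrE ?mulr_ge0//.
  by rewrite -natrM ler_nat leq_addr.
apply: le_trans (bound N alpha (leq_trans _ N4)) _ => //.
apply: le_trans (_ : C * 2 ^+ N * expR (N%:R * ln n%:R + n%:R * (ln r1 + 1) -
    ln n`!%:R / 2) <= _).
  by rewrite ler_pM2l ?mulr_gt0 ?exprn_gt0// ler_expR.
rewrite -(addrA (N%:R * _)) [in leLHS]expRD expRM_natl lnK ?posrE// exprMn.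
rewrite [leLHS](_ : _ = 2 ^+ N * n%:R ^+ N *
  (C * expR (n%:R * (ln r1 + 1) - ln n`!%:R / 2))); last ring.
rewrite ler_pM2l ?mulr_gt0 ?exprn_gt0//.
apply: ler_pM; rewrite ?expR_ge0 ?(ltW C0)//.
  by rewrite lerDl mulr_ge0// ltW.
by rewrite ler_expR; lra.
Qed.
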